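(* Let $\mathfrak X=(\mathbb R^d,d_{\rm e},\mu)$, $d\in\mathbb N$, with $d_{\rm e}$ the Euclidean metric and $\mu$ a Borel measure such that $\mu(B)\in(0,\infty)$ for every open ball $B$. Then the centered maximal operator $\mathcal M^{\rm c}_{\mathfrak X}$ possesses the dichotomy property if and only if there exists $y_0\in\mathbb R^d$ with $\limsup_{r\to\infty}\frac{\mu(B_{r+1}(y_0))}{\mu(B_r(y_0))}<\infty$.
   Context: $B_r(x)$ is the open Euclidean ball of center $x$ and radius $r$. $L^1_{\rm loc}(\mu)$: functions integrable on every open ball. $\mathcal M^{\rm c}f(x)=\sup_{r>0}\mu(B_r(x))^{-1}\int_{B_r(x)}|f|d\mu$. $\mathcal M^{\rm c}$ possesses the dichotomy property if for every $f\in L^1_{\rm loc}(\mu)$ either $\mu(\{\mathcal M^{\rm c}f=\infty\})=0$ or $\mathcal M^{\rm c}f(x)=\infty$ for all $x$. *)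

(* Defs.v *)
From HB Require Import structures.
From mathcomp Require Import all_boot all_order all_algebra.
From mathcomp Require Import all_classical all_reals all_analysis.
Set Implicit Arguments. Unset Strict Implicit. Unset Printing Implicit Defensive.
Import Order.TTheory GRing.Theory Num.Theory.
Import numFieldNormedType.Exports.
Local Open Scope classical_set_scope.
Local Open Scope ring_scope.

(* R^d is modelled as row vectors 'rV[R]_d with their (product = Euclidean)
   topology; the Borel sigma-algebra is the one generated by the open sets. *)
Definition borel_Rd (R : realType) (d : nat) :=
  g_sigma_algebraType (@open 'rV[R]_d).

Definition edist (R : realType) (d : nat) (x y : 'rV[R]_d) : R :=
  Num.sqrt (\sum_(i < d) (x ord0 i - y ord0 i) ^+ 2).

Definition eball (R : realType) (d : nat) (x : 'rV[R]_d) (r : R)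
  : set (borel_Rd R d) := [set y | edist x y < r].

Section maximal.
Context (R : realType) (d : nat).
Local Notation T := (borel_Rd R d).
Variable mu : {measure set T -> \bar R}.
Local Open Scope ereal_scope.

Definition L1loc (f : T -> R) : Prop :=
  forall (x : T) (r : R), (0 < r)%R -> mu.-integrable (eball x r) (EFin \o f).

Definition Mc (f : T -> R) (x : T) : \bar R :=
  ereal_sup [set ((fine (mu (eball x r)))^-1)%:E *
                 \int[mu]_(y in eball x r) (`|f y|)%:E
            | r in [set r : R | (0 < r)%R]].

Definition dichotomy : Prop :=
  forall f : T -> R, L1loc f ->
    mu.-negligible [set x | Mc f x = +oo] \/ (forall x, Mc f x = +oo).

Definition ball_ratio (y0 : T) (r : R) : \bar R :=
  (fine (mu (eball y0 (r + 1))) / fine (mu (eball y0 r)))%:E.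
End maximal.

(* Main.v *)
(* Sufficiency.  Choosing balls greedily by decreasing radius bounds their
   overlap by a constant depending on d only, whatever the measure is.  This
   yields a weak type estimate for the averages over radii at most 1, so these
   averages are bounded at almost every point.  Hence, if M^c f = oo on a set
   that is not negligible, then the averages over large balls are unbounded at
   some point x, and bounded growth of the balls transfers this to every point.

   Necessity.  If the growth is unbounded at 0, then there are radii r_k -> oo
   and a half-space {s p_0 >= 0}, s = 1 or -1, whose intersection with the
   annulus r_k <= |p| < r_k + 1 has measure at least 4^k mu(B_{r_k}(0)).  Put a
   mass 2^k mu(B_{r_k}(0)) near the point at distance r_k - 1 from 0 in the
   direction opposite to the half-space.  Points close to 0 see this mass in a
   ball contained in B_{r_k}(0), so M^c f = oo there.  A ball centered at 4 s e_0
   which reaches this mass already contains the k-th half annulus, so that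
   M^c f(4 s e_0) <= 2. *)

Require Import Defs.
From HB Require Import structures.
From mathcomp Require Import all_boot all_order all_algebra.
From mathcomp Require Import all_classical all_reals all_analysis.
From mathcomp Require Import measurable_realfun ring lra.
Import Order.TTheory GRing.Theory Num.Theory.
Import numFieldNormedType.Exports.
Local Open Scope classical_set_scope.
Local Open Scope ring_scope.

(* [all_analysis] exports an unrelated [edist], which shadows [Defs.edist]. *)
Local Notation edist := Defs.edist.

(** * Euclidean distance: Cauchy-Schwarz, separated sets and angles *)

Section euclidean_geometry.
Context {R : realType} {d : nat}.
Implicit Types x y z p : 'rV[R]_d.

(** Expanding the nonnegative sum of the squares of [B * a i - C * b i] gives
    [B * (A * B - C ^+ 2)]. Cancelling [B] requires [0 < B]; if [B = 0], every [b i] vanishes. *)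
Lemma sum_CauchySchwarz (a b : 'I_d -> R) :
  (\sum_i a i * b i) ^+ 2 <= (\sum_i a i ^+ 2) * (\sum_i b i ^+ 2).
Proof.
set C := \sum_i a i * b i; set A := \sum_i a i ^+ 2; set B := \sum_i b i ^+ 2.
have B0 : 0 <= B by apply: sumr_ge0 => i _; exact: sqr_ge0.
have : 0 <= \sum_i (B * a i - C * b i) ^+ 2.
  by apply: sumr_ge0 => i _; exact: sqr_ge0.
have -> : \sum_i (B * a i - C * b i) ^+ 2 = B * (A * B - C ^+ 2).
  transitivity (\sum_i (B ^+ 2 * a i ^+ 2 + (- 2 * B * C) * (a i * b i)
      + C ^+ 2 * b i ^+ 2)); first by apply: eq_bigr => i _; ring.
  by rewrite !big_split /= -!mulr_sumr -/A -/B -/C; ring.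
have [B_gt0|] := ltP 0 B; first by rewrite pmulr_rge0// subr_ge0.
move=> B_le0 _; have {B_le0 B0} B0 : B = 0 by apply/eqP; rewrite eq_le B_le0.
have b0 i : b i = 0.
  apply/eqP; rewrite -sqrf_eq0; apply/eqP.
  by apply: (psumr_eq0P _ B0) => // j _; exact: sqr_ge0.
rewrite /C big1 ?expr0n/= ?B0 ?mulr0// => i _.
by rewrite b0 mulr0.
Qed.

Lemma euclid_ge0 x y : 0 <= edist x y.
Proof. exact: sqrtr_ge0. Qed.

Lemma euclidxx x : edist x x = 0.
Proof. by rewrite /edist big1 ?sqrtr0// => i _; rewrite subrr expr0n. Qed.

Lemma euclidC x y : edist x y = edist y x.
Proof. by congr Num.sqrt; apply: eq_bigr => i _; rewrite -sqrrN opprB. Qed.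

Lemma sqr_edist x y : edist x y ^+ 2 = \sum_i (x ord0 i - y ord0 i) ^+ 2.
Proof. by rewrite sqr_sqrtr// sumr_ge0// => i _; exact: sqr_ge0. Qed.

(** Law of cosines with apex [p]. *)
Lemma sqr_edistE p x y : edist x y ^+ 2 = edist x p ^+ 2 + edist y p ^+ 2
  - 2 * \sum_i (x ord0 i - p ord0 i) * (y ord0 i - p ord0 i).
Proof.
rewrite !sqr_edist mulr_sumr -big_split/= -sumrB.
by apply: eq_bigr => i _; ring.
Qed.

Lemma edist_inner_le p x y :
  `|\sum_i (x ord0 i - p ord0 i) * (y ord0 i - p ord0 i)| <=
  edist x p * edist y p.
Proof.
rewrite -(ler_pXn2r (ltn0Sn 1)) ?nnegrE ?mulr_ge0 ?euclid_ge0//.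
rewrite real_normK ?num_real// exprMn !sqr_edist.
exact: sum_CauchySchwarz.
Qed.

Lemma euclid_triangle y x z : edist x z <= edist x y + edist y z.
Proof.
rewrite -(ler_pXn2r (ltn0Sn 1)) ?nnegrE ?addr_ge0 ?euclid_ge0//.
have := edist_inner_le y x z; rewrite ler_norml => /andP[+ _].
by rewrite (sqr_edistE y) (euclidC y z); nra.
Qed.

Lemma coord_le_edist x y i : `|x ord0 i - y ord0 i| <= edist x y.
Proof.
rewrite -sqrtr_sqr ler_wsqrtr// (bigD1 i)//= lerDl sumr_ge0// => j _.
exact: sqr_ge0.
Qed.

(** The divisor [d.+1] also serves [d = 0] and keeps the inequality strict, because
    [d < d.+1 ^ 2]. *)
Lemma edist_lt_coord x y (e : R) : 0 < e ->
  (forall i, `|x ord0 i - y ord0 i| < e / d.+1%:R) -> edist x y < e.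
Proof.
move=> e0 xy; rewrite -(ltr_pXn2r (ltn0Sn 1)) ?nnegrE ?euclid_ge0 ?(ltW e0)//.
have d0 : 0 < d.+1%:R :> R by rewrite ltr0n.
rewrite sqr_edist (@le_lt_trans _ _ (\sum_(i < d) (e / d.+1%:R) ^+ 2))//.
  apply: ler_sum => i _; rewrite -(real_normK (num_real _)).
  have eh : 0 <= e / d.+1%:R by rewrite divr_ge0 ?(ltW e0).
  by rewrite ler_pXn2r ?nnegrE// ltW.
rewrite sumr_const card_ord -[_ *+ d]mulr_natr expr_div_n -mulrA gtr_pMr ?exprn_gt0//.
rewrite mulrC ltr_pdivrMr ?exprn_gt0// mul1r -natrX ltr_nat expnS expn1.
by apply: (@leq_ltn_trans (d * d.+1)%N); rewrite ?leq_pmulr// ltn_pmul2r.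
Qed.

Lemma euclidZ (a : R) x y : edist (a *: x) (a *: y) = `|a| * edist x y.
Proof.
rewrite /edist -sqrtr_sqr -sqrtrM ?sqr_ge0//; congr Num.sqrt.
by rewrite mulr_sumr; apply: eq_bigr => i _; rewrite !mxE; ring.
Qed.

(* Points in the same cell of a grid of mesh [e / (d + 1)] are at distance
   less than [e], so a separated family meets each cell at most once. *)
Lemma separated_size_bound (L e : R) : 0 < e -> exists N : nat,
  forall t : seq 'rV[R]_d, (forall x, x \in t -> forall i, `|x ord0 i| <= L) ->
  pairwise (fun x y => e <= edist x y) t -> (size t <= N)%N.
Proof.
move=> e0; pose h := e / d.+1%:R.
have h0 : 0 < h by rewrite divr_gt0// ltr0n.
pose M := Num.truncn ((L + L) / h).
(* Index of the grid cell of [x]; the shift by [L] makes the coordinates nonnegative, so that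
   truncation acts as the floor. *)
pose c x : {ffun 'I_d -> 'I_M.+1} :=
  [ffun i => inord (Num.truncn ((x ord0 i + L) / h))].
exists #|{ffun 'I_d -> 'I_M.+1}| => t tL te.
suff : uniq (map c t).
  by move/card_uniqP; rewrite size_map => <-; exact: max_card.
rewrite uniq_pairwise pairwise_map.
apply: (@sub_in_pairwise _ (mem t) _ _ _ _ _ te); last exact/allP.
move=> x y /= xt yt; apply: contraTneq => cxy; rewrite -ltNge.
apply: edist_lt_coord => // i.
have bnd z : z \in t -> 0 <= (z ord0 i + L) / h /\
    (Num.truncn ((z ord0 i + L) / h) < M.+1)%N.
  move=> /tL /(_ i); rewrite ler_norml => /andP[zl zr].
  split; first by rewrite divr_ge0 ?(ltW h0)//; lra.
  by rewrite ltnS /M le_truncn// ler_pM2r ?invr_gt0//; lra.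
have := congr1 (fun f : {ffun 'I_d -> 'I_M.+1} => nat_of_ord (f i)) cxy.
rewrite !ffunE !inordK; [|exact: (bnd _ yt).2|exact: (bnd _ xt).2].
move=> exy.
have /andP[x1 x2] := truncn_itv (bnd _ xt).1.
have /andP[y1 y2] := truncn_itv (bnd _ yt).1.
rewrite exy in x1 x2.
have : `|(x ord0 i + L) / h - (y ord0 i + L) / h| < 1.
  by rewrite ltr_norml -natr1 in x2 y2 *; lra.
rewrite -mulrBl normrM (ger0_norm (_ : 0 <= h^-1)) ?invr_ge0 ?(ltW h0)//.
by rewrite ltr_pdivrMr// mul1r; congr (`|_| < _); ring.
Qed.

(* Seen from [p], the centers of the balls are at angles at least 60 degrees
   apart. *)
Lemma ball_overlap_bound : exists K : nat, forall (p : 'rV[R]_d)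
  (s : seq ('rV[R]_d * R)),
  pairwise (fun u v => Num.max u.2 v.2 <= edist u.1 v.1) s ->
  (count (fun u => edist u.1 p < u.2)%R s <= K)%N.
Proof.
have [N NP] := separated_size_bound 1 1 ltr01.
exists N => p s sep; rewrite -size_filter.
set t := seq.filter _ s.
have tsep : pairwise (fun u v => Num.max u.2 v.2 <= edist u.1 v.1) t.
  exact: pairwise_filter.
have tp u : u \in t -> edist u.1 p < u.2 by rewrite mem_filter => /andP[].
(* Unit vector from [p] towards the center of [u], or 0 if that center is [p]. These vectors will be
   shown to be 1-separated in the unit cube. *)
pose g (u : 'rV[R]_d * R) : 'rV[R]_d := (edist u.1 p)^-1 *: (u.1 - p).
have g0 u : edist (g u) 0 = (edist u.1 p)^-1 * edist u.1 p.
  rewrite -(scaler0 _ (edist u.1 p)^-1) euclidZ ger0_norm ?invr_ge0 ?euclid_ge0//.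
  by congr (_ * Num.sqrt _); apply: eq_bigr => i _; rewrite !mxE; ring.
rewrite -(size_map g); apply: NP => [_ /mapP[u ut ->] i|].
  have := coord_le_edist (g u) 0 i; rewrite [X in _ - X]mxE subr0 => /le_trans; apply.
  rewrite g0; have [->|u0] := eqVneq (edist u.1 p) 0; first by rewrite mulr0.
  by rewrite mulVf.
rewrite pairwise_map.
apply: (@sub_in_pairwise _ (mem t) _ _ _ _ _ tsep); last exact/allP.
move=> u v /= /tp up /tp vp uv.
have tri : edist u.1 v.1 <= edist u.1 p + edist v.1 p.
  by rewrite (euclidC v.1 p) euclid_triangle.
move: uv; rewrite ge_max => /andP[u2 v2].
have := euclid_ge0 u.1 p; have := euclid_ge0 v.1 p.
(* If one center is [p], the other lies within its own radius of it, against separation. *)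
rewrite le0r => /orP[/eqP v0|v0]; first lra.
rewrite le0r => /orP[/eqP u0|u0]; first lra.
rewrite -(ler_pXn2r (ltn0Sn 1)) ?nnegrE ?euclid_ge0// expr1n.
rewrite (sqr_edistE 0) !g0 !mulVf ?gt_eqF//.
have := sqr_edistE p u.1 v.1.
set S := \sum_i _ => uvE.
have -> : \sum_i (g u ord0 i - (0 : 'rV[R]_d) ord0 i) *
    (g v ord0 i - (0 : 'rV[R]_d) ord0 i) = S / (edist u.1 p * edist v.1 p).
  rewrite mulr_suml; apply: eq_bigr => i _.
  by rewrite !mxE; field; rewrite !gt_eqF.
(* Unit vectors are at distance at least 1 when their inner product is at most 1/2. By separation,
   the two centers are at least as far apart as the farther one is from [p], so the law of cosines
   bounds [2 * S] by the square of the smaller distance to [p]. *)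
suff : S / (edist u.1 p * edist v.1 p) <= 2^-1 by lra.
rewrite ler_pdivrMr ?mulr_gt0//.
have [uv|/ltW vu] := leP (edist u.1 p) (edist v.1 p).
  have : edist v.1 p ^+ 2 <= edist u.1 v.1 ^+ 2.
    by rewrite ler_pXn2r ?nnegrE ?euclid_ge0//; lra.
  by rewrite uvE; nra.
have : edist u.1 p ^+ 2 <= edist u.1 v.1 ^+ 2.
  by rewrite ler_pXn2r ?nnegrE ?euclid_ge0//; lra.
by rewrite uvE; nra.
Qed.
End euclidean_geometry.

(** * Greedy selection of separated balls *)

Section greedy_selection.
Context {R : realType} {d : nat}.
Implicit Types x y : 'rV[R]_d.

(** A separated family in [S] of maximal size exists because sizes are bounded; an uncovered point
    could be added to it. *)
Lemma separated_net (S : set 'rV[R]_d) (L r : R) : 0 < r ->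
  (forall x, S x -> forall i, `|x ord0 i| <= L) ->
  exists t : seq 'rV[R]_d, [/\ forall x, x \in t -> S x,
    pairwise (fun x y => r <= edist x y) t &
    forall x, S x -> exists2 y, y \in t & edist y x < r].
Proof.
move=> r0 SL; have [N NP] := @separated_size_bound R d L r r0.
pose P n := `[< exists t : seq 'rV[R]_d, [/\ size t = n, forall x, x \in t -> S x
  & pairwise (fun x y => r <= edist x y) t] >].
have P0 : exists n, P n by exists 0%N; apply/asboolP; exists [::]; split.
have PN n : P n -> (n <= N)%N.
  by move=> /asboolP[t [<- tS tr]]; apply: NP => // x /tS /SL.
case: (ex_maxnP P0 PN) => n /asboolP[t [tn tS tr]] nmax.
exists t; split=> // x Sx; apply: contrapT => xt.
suff /nmax : P n.+1 by rewrite ltnn.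
apply/asboolP; exists (x :: t); split => /=; first by rewrite tn.
  by move=> y; rewrite inE => /predU1P[->|/tS].
rewrite tr andbT; apply/allP => y yt; rewrite leNgt; apply/negP => xy.
by apply: xt; exists y => //; rewrite euclidC.
Qed.

(* Radii are treated in decreasing order; for each of them one adds a maximal
   separated set of the centers that are not yet covered. *)
Lemma greedy_balls (A : R -> set 'rV[R]_d) (L : R) (l : seq R) :
  sorted <=%R l -> (forall r, r \in l -> 0 < r) ->
  (forall r x, A r x -> forall i, `|x ord0 i| <= L) ->
  exists s : seq ('rV[R]_d * R), [/\
    forall u, u \in s -> u.2 \in l /\ A u.2 u.1,
    pairwise (fun u v => Num.max u.2 v.2 <= edist u.1 v.1) s &
    forall r x, r \in l -> A r x -> exists2 u, u \in s & edist u.1 x < u.2].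
Proof.
move=> + + AL; elim: l => [|r l IH] ls l0; first by exists [::].
(* The list increases, so the induction hypothesis has already selected balls for the radii in the
   tail, all at least [r]. *)
have [|r' r'l|s [sA ss scov]] := IH; first exact: path_sorted ls.
  by apply: l0; rewrite inE r'l orbT.
have rl r' : r' \in l -> r <= r'.
  by move: r'; apply/allP; apply: order_path_min ls; exact: le_trans.
pose S : set 'rV[R]_d :=
  [set x | A r x /\ forall u, u \in s -> u.2 <= edist u.1 x].
have [||t [tS tr tcov]] := @separated_net S L r.
- by apply: l0; rewrite mem_head.
- by move=> x [/AL].
exists (s ++ [seq (x, r) | x <- t]); split.
- move=> u; rewrite mem_cat => /orP[/sA[ul Au]|/mapP[x /tS[Ax _] ->]]/=.
    by rewrite inE ul orbT.
  by rewrite mem_head.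
- rewrite pairwise_cat ss/= pairwise_map; apply/andP; split.
    apply/allrelP => u _ us /mapP[x xt ->]/=.
    rewrite (max_idPl _); first exact: (tS _ xt).2.
    by apply: rl; have [] := sA _ us.
  by apply: sub_pairwise tr => x y /=; rewrite maxxx.
- move=> r' x; rewrite inE => /predU1P[->|r'l] Ax; last first.
    have [u us ux] := scov _ _ r'l Ax.
    by exists u => //; rewrite mem_cat us.
  have [Sx|nSx] := pselect (S x).
    have [y yt yx] := tcov _ Sx; exists (y, r) => //.
    by rewrite mem_cat map_f ?orbT.
  have [u [us ux]] : exists u, u \in s /\ edist u.1 x < u.2.
    apply: contrapT => nu; apply: nSx; split=> // u us.
    by rewrite leNgt; apply/negP => ux; apply: nu; exists u.
  by exists u => //; rewrite mem_cat us.
Qed.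
End greedy_selection.

(** * Balls as Borel sets, inclusions and exhaustions *)

Section euclidean_balls.
Context {R : realType} {d : nat}.
Local Notation T := (borel_Rd R d).
Implicit Types x y : T.

Lemma continuous_edist x : continuous (fun y : 'rV[R]_d => edist x y).
Proof.
move=> y; apply: (continuous_comp
  (f := fun z : 'rV[R]_d => \sum_i (x ord0 i - z ord0 i) ^+ 2)); last first.
  exact: sqrt_continuous.
apply: continuous_big => [|i _]; first exact: add_continuous.
move=> {}y.
apply: (continuous_comp (f := fun z : 'rV[R]_d => x ord0 i - z ord0 i)
    (g := fun t => t ^+ 2)); last first.
  exact: exprn_continuous.
apply: (@continuousB _ R^o _ (fun=> x ord0 i) (fun z : 'rV[R]_d => z ord0 i)).
  exact: cst_continuous.
exact: (@coord_continuous R 1 d ord0 i y).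
Qed.

Lemma measurable_eball x (r : R) : measurable (eball x r).
Proof.
apply: sub_sigma_algebra; rewrite (_ : eball x r =
  (fun y : 'rV[R]_d => edist x y) @^-1` [set z | z < r])//.
apply: open_comp; last exact: open_lt.
by move=> y _; exact: continuous_edist.
Qed.

Lemma subset_eball x y (r s : R) : edist x y + r <= s -> eball x r `<=` eball y s.
Proof.
move=> rs z; rewrite /eball /= => xz; have := euclid_triangle x y z.
by rewrite (euclidC y x); lra.
Qed.

Lemma subset_eball_radius x (r s : R) : r <= s -> eball x r `<=` eball x s.
Proof. by move=> rs; apply: subset_eball; rewrite euclidxx add0r. Qed.

Lemma eball_bigcup x (r : R) : eball x r = \bigcup_n eball x (r - n.+1%:R^-1).
Proof.
apply/seteqP; split => [y|y [n _]]; rewrite /eball/=; last first.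
  by move=> /lt_le_trans; apply; rewrite gerBl invr_ge0.
rewrite -subr_gt0 => /ltr_add_invr.
move=> [n]; rewrite add0r => nr; exists n => //=.
by rewrite ltrBrDl -ltrBrDr.
Qed.

Lemma bigcup_eball_nat : \bigcup_n eball (0 : T) n%:R = setT.
Proof.
apply/seteqP; split => // y _; exists (Num.truncn (edist (0 : T) y)).+1 => //.
by rewrite /eball/= truncnS_gt.
Qed.
End euclidean_balls.

(** * Weak type estimate for finitely many radii *)

Section local_maximal_estimate.
Context {R : realType} {d : nat}.
Local Notation T := (borel_Rd R d).
Context (mu : {measure set T -> \bar R}) (g : T -> \bar R).
Hypothesis mg : measurable_fun [set: T] g.
Hypothesis g0 : forall x, (0 <= g x)%E.
Local Open Scope ereal_scope.
Local Notation nu := (fun A : set T => \int[mu]_(y in A) g y).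

Let mgD (D : set T) : measurable_fun D g.
Proof. exact: measurable_funTS. Qed.

(** The sum of the indicators of the balls is at most [K] everywhere; multiply by [g] and integrate
    over [D]. *)
Lemma overlap_integral (K : nat) (D : set T) (s : seq ('rV[R]_d * R)) :
  measurable D -> (forall u, u \in s -> eball u.1 u.2 `<=` D) ->
  (forall p, (count (fun u => edist u.1 p < u.2)%R s <= K)%N) ->
  \sum_(u <- s) nu (eball u.1 u.2) <= K%:R%:E * nu D.
Proof.
move=> mD sD sK.
have mgu (u : 'rV[R]_d * R) : measurable_fun D (g \_ (eball u.1 u.2)).
  apply/(measurable_restrict _ (measurable_eball _ _) mD).
  exact: mgD.
have gu0 (u : 'rV[R]_d * R) (x : T) : D x -> 0 <= (g \_ (eball u.1 u.2)) x.
  by move=> _; rewrite patchE; case: ifP.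
rewrite (_ : \sum_(u <- s) _ =
    \int[mu]_(x in D) \sum_(u <- s) (g \_ (eball u.1 u.2)) x); last first.
  rewrite ge0_integral_sum//; apply: eq_big_seq => u us.
  by rewrite -integral_mkcondr setIidr//; exact: sD.
rewrite -ge0_integralZl ?lee_fin ?ler0n//.
apply: ge0_le_integral => //.
- by move=> x Dx; apply: sume_ge0 => u _; exact: gu0.
- by apply: emeasurable_sum.
- by apply: measurable_funeM.
move=> x Dx; apply: (@le_trans _ _
  ((count (fun u => edist u.1 x < u.2)%R s)%:R%:E * g x)); last first.
  by rewrite lee_wpmul2r// lee_fin ler_nat sK.
elim: s {sD sK} => [|u s IH]; first by rewrite big_nil mul0e.
rewrite big_cons/= natrD EFinD ge0_muleDl ?lee_fin ?ler0n//.
apply: leeD => //; rewrite patchE.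
case: ifPn => [|_]; last by rewrite mule_ge0 ?lee_fin ?ler0n.
by rewrite inE /eball/= => ->; rewrite mul1e.
Qed.

Lemma cover_measure (c : R) (s : seq ('rV[R]_d * R)) : (0 <= c)%R ->
  (forall u, u \in s -> c%:E * mu (eball u.1 u.2) <= nu (eball u.1 u.2)) ->
  exists G : set T, [/\ measurable G, forall u, u \in s -> eball u.1 u.2 `<=` G &
    c%:E * mu G <= \sum_(u <- s) nu (eball u.1 u.2)].
Proof.
move=> c0; elim: s => [|u s IH] us.
  by exists set0; split => //; rewrite measure0 mule0 big_nil.
have [|G [mG sG cG]] := IH; first by move=> v vs; apply: us; rewrite inE vs orbT.
exists (eball u.1 u.2 `|` G); split.
- by apply: measurableU => //; exact: measurable_eball.
- move=> v; rewrite inE => /predU1P[->|/sG vG] => x; first by left.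
  by move=> /vG; right.
- rewrite big_cons; apply: (@le_trans _ _
    (c%:E * (mu (eball u.1 u.2) + mu G))).
    by rewrite lee_wpmul2l ?lee_fin// measureU2//; exact: measurable_eball.
  by rewrite ge0_muleDr// leeD// us// mem_head.
Qed.

(** Open balls are increasing unions of smaller concentric balls, so [nu] is continuous from below
    in the radius. This allows a radius to be rounded down to a grid. *)
Lemma lt_nu_smaller_radius (x : T) (r : R) (a : \bar R) :
  a < nu (eball x r) -> exists2 r' : R, (r' < r)%R &
    forall t : R, (r' <= t)%R -> a < nu (eball x t).
Proof.
move=> ar.
pose F n := eball x (r - n.+1%:R^-1).
have nF : {homo F : n m / (n <= m)%N >-> (n <= m)%O}.
  move=> n m nm; apply/subsetPset; apply: subset_eball_radius.
  by rewrite lerD2l lerN2 lef_pV2 ?posrE ?ltr0n// ler_nat.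
have mF n : measurable (F n) by exact: measurable_eball.
have := ge0_nondecreasing_set_cvg_integral nF mF (fun n => mgD (F n))
  (fun n x _ => g0 x) (mu := mu).
rewrite -eball_bigcup => /(cvg_lim (@ereal_hausdorff _)).
have ndi : nondecreasing_seq (fun n => nu (F n)).
  move=> n m nm; apply: ge0_subset_integral => //.
  exact/subsetPset/nF.
rewrite (cvg_lim (@ereal_hausdorff _) (ereal_nondecreasing_cvgn ndi)) => supE.
move: ar; rewrite -supE => /ereal_sup_gt[_ [n _ <-] an].
exists (r - n.+1%:R^-1)%R; first by rewrite ltrBlDr ltrDl invr_gt0.
move=> t rt; apply: (lt_le_trans an); apply: ge0_subset_integral => //.
- exact: measurable_eball.
- exact: subset_eball_radius.
Qed.

(** [G] is the union of greedily selected balls, which contain every bad center; it is measurable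
    whether or not the set of bad centers is. Radii at most 1 keep the balls inside
    [eball 0 (N + 1)]. The overlap bound [K] is a parameter, so that one constant serves all lists
    [l]. *)
Lemma weak_type_finite (N c : R) (l : seq R) (K : nat) : (0 < c)%R ->
  (forall (p : 'rV[R]_d) (s : seq ('rV[R]_d * R)),
    pairwise (fun u v => Num.max u.2 v.2 <= edist u.1 v.1)%R s ->
    (count (fun u => edist u.1 p < u.2)%R s <= K)%N) ->
  (forall r, r \in l -> 0 < r <= 1)%R ->
  exists G : set T, [/\ measurable G,
    forall (r : R) (x : T), r \in l -> (edist 0 x <= N)%R ->
      c%:E * mu (eball x r) <= nu (eball x r) -> G x &
    c%:E * mu G <= K%:R%:E * nu (eball 0 (N + 1))].
Proof.
move=> c0 KP l01.
pose A (r : R) : set 'rV[R]_d := [set x | (edist 0 x <= N)%R /\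
  c%:E * mu (eball x r) <= nu (eball x r)].
have [|||s [sA ss scov]] := @greedy_balls R d A N (sort <=%R l).
- by apply: sort_sorted; exact: le_total.
- by move=> r; rewrite mem_sort => /l01/andP[].
- move=> r x [xN _] i; have := coord_le_edist 0 x i.
  by rewrite [X in (X - _)%R]mxE sub0r normrN => /le_trans; apply.
have [|G [mG sG cG]] := cover_measure c s (ltW c0).
  by move=> u /sA[_ []].
exists G; split => //.
- move=> r x rl xN cx; have [||u us ux] := scov r x; rewrite ?mem_sort//.
  exact: (sG _ us).
- apply: (le_trans cG); apply: overlap_integral.
  + exact: measurable_eball.
  + move=> u /sA[]; rewrite mem_sort => /l01 /andP[_ u1] [uN _].
    by apply: subset_eball; rewrite euclidC lerD.
  + by move=> p; exact: KP.
Qed.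
End local_maximal_estimate.

(** * Averages over radii at most 1 are bounded at almost every point *)

Section local_maximal_finiteness.
Context {R : realType} {d : nat}.
Local Notation T := (borel_Rd R d).
Context (mu : {measure set T -> \bar R}) (g : T -> \bar R).
Hypothesis mg : measurable_fun [set: T] g.
Hypothesis g0 : forall x, (0 <= g x)%E.
Hypothesis gfin : forall x (r : R), (\int[mu]_(y in eball x r) g y < +oo)%E.
Local Open Scope ereal_scope.
Local Notation nu := (fun A : set T => \int[mu]_(y in A) g y).

(* The radii are first restricted to multiples of [1 / (m + 1)], and [m] tends
   to infinity. *)
Lemma weak_type (N : R) : exists2 C : R, (0 <= C)%R &
  forall c : R, (0 < c)%R -> exists G : set T, [/\ measurable G,
    forall (x : T) (r : R), (edist 0 x <= N)%R -> (0 < r <= 1)%R ->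
      c%:E * mu (eball x r) < nu (eball x r) -> G x &
    mu G <= (C / c)%:E].
Proof.
have [K KP] := @ball_overlap_bound R d.
have nu0 A : 0 <= nu A by exact: integral_ge0.
exists (K%:R * fine (nu (eball 0 (N + 1))))%R.
  by rewrite mulr_ge0 ?fine_ge0.
move=> c c0.
pose l (m : nat) : seq R := [seq (k%:R / m.+1%:R)%R | k <- iota 1 m.+1].
have l01 m r : r \in l m -> (0 < r <= 1)%R.
  move=> /mapP[k]; rewrite mem_iota => /andP[k1 km] ->.
  by rewrite divr_gt0 ?ltr0n// ler_pdivrMr ?ltr0n// mul1r ler_nat -ltnS.
have [G GP] := choice (fun m => @weak_type_finite R d mu g mg g0 N c (l m) K
  c0 KP (l01 m)).
have mG m : measurable (G m) by have [] := GP m.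
have GC m : mu (G m) <= (K%:R * fine (nu (eball 0 (N + 1))) / c)%:E.
  have [_ _ cG] := GP m.
  by rewrite EFinM muleC lee_pdivlMl// EFinM fineK// ge0_fin_numE.
(* The sets [G m] need not be monotone. The tail intersections are, and their union, the lower limit
   of [G], inherits the uniform bound. *)
pose F m := \bigcap_(k in [set k | (m <= k)%N]) G k.
have mF m : measurable (F m) by apply: bigcap_measurableType.
exists (\bigcup_m F m); split.
- exact: bigcupT_measurable.
- move=> x r xN /andP[r0 r1] /(lt_nu_smaller_radius mu g mg g0)[r' r'r nut].
  (* Once the mesh is smaller than this gap, the largest grid multiple below [r] lies above
     [Num.max r' 0]: it is a positive radius at which the integral still exceeds [c] times the
     measure of the larger ball. *)
  have : (0 < r - Num.max r' 0)%R by rewrite subr_gt0 gt_max r'r.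
  move=> /ltr_add_invr[m]; rewrite add0r => mr.
  exists m => // n /= mn.
  have nr : (n.+1%:R^-1 < r - Num.max r' 0)%R.
    by apply: le_lt_trans mr; rewrite lef_pV2 ?posrE ?ltr0n// ler_nat.
  pose k := Num.truncn (r * n.+1%:R).
  have /andP[kr rk] : (k%:R <= r * n.+1%:R < k.+1%:R)%R.
    by apply: truncn_itv; rewrite mulr_ge0 ?(ltW r0).
  have tr : (k%:R / n.+1%:R <= r)%R by rewrite ler_pdivrMr ?ltr0n.
  have rt : (Num.max r' 0 < k%:R / n.+1%:R)%R.
    rewrite ltr_pdivlMr ?ltr0n//.
    move: nr; rewrite ltrBrDr -ltrBrDl -(ltr_pM2r (_ : 0 < n.+1%:R)%R) ?ltr0n//.
    rewrite mulrBl mulVf ?pnatr_eq0// => /lt_le_trans; apply.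
    by rewrite lerBlDr natr1 ltW.
  move: rt; rewrite gt_max => /andP[/ltW r't t0].
  have [_ GnP _] := GP n; apply: (GnP (k%:R / n.+1%:R)%R) => //.
    apply/mapP; exists k => //; rewrite mem_iota add1n ltnS; apply/andP; split.
      by move: t0; rewrite pmulr_lgt0 ?invr_gt0 ?ltr0n.
    rewrite -(ler_nat R); apply: (le_trans kr).
    by rewrite ler_piMl.
  apply/ltW/(le_lt_trans _ (nut _ r't)).
  rewrite lee_wpmul2l ?lee_fin ?(ltW c0)//.
  by apply: le_measure; rewrite ?inE; try exact: measurable_eball;
    exact: subset_eball_radius.
- have ndF : {homo F : n m / (n <= m)%N >-> (n <= m)%O}.
    move=> n m nm; apply/subsetPset => x Fnx k /= mk.
    by apply: Fnx => /=; exact: leq_trans mk.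
  have := nondecreasing_cvg_mu mF (bigcupT_measurable F mF) ndF (mu := mu).
  move=> cF; rewrite -(cvg_lim (@ereal_hausdorff _) cF); apply: lime_le.
    by apply/cvg_ex; exists (mu (\bigcup_m F m)).
  near=> m => /=; apply: le_trans (GC m).
  apply: le_measure; rewrite ?inE//.
  by apply: bigcap_inf => /=.
Unshelve. all: by end_near.
Qed.

(** Inside a fixed ball, the weak type bound with [c = n.+1] covers the set by a set of measure at
    most [C / n.+1], for every [n]. *)
Lemma negligible_local_infinite : mu.-negligible
  [set x : T | forall n : nat, exists2 r : R, (0 < r <= 1)%R &
    n%:R%:E * mu (eball x r) < nu (eball x r)].
Proof.
set E := [set x | _].
suff EN (N : nat) : mu.-negligible (E `&` [set x | edist 0 x <= N%:R]%R).
  apply: negligibleS (negligible_bigcup EN) => x Ex.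
  exists (Num.truncn (edist 0 x)).+1 => //; split => //=.
  by rewrite ltW// truncnS_gt.
have [C C0 GP] := weak_type N%:R.
have n0 n : (0 < n.+1%:R :> R)%R by rewrite ltr0n.
have [G {}GP] := choice (fun n => GP _ (n0 n)).
exists (\bigcap_n G n); split.
- by apply: bigcapT_measurable => n; have [] := GP n.
- have mGn n : mu (\bigcap_n G n) <= (C / n.+1%:R)%:E.
    have [mG _ GC] := GP n; apply: le_trans GC.
    apply: le_measure; rewrite ?inE//; last exact: bigcap_inf.
    by apply: bigcapT_measurable => k; have [] := GP k.
  have : mu (\bigcap_n G n) \is a fin_num.
    by rewrite ge0_fin_numE// (le_lt_trans (mGn 0%N))// ltry.
  move=> /fineK; set h := fine _ => hE; rewrite -hE; congr EFin.
  apply/eqP; rewrite eq_le fine_ge0// andbT leNgt; apply/negP => h0.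
  have := mGn (Num.truncn (C / h)); rewrite -hE lee_fin.
  rewrite ler_pdivlMr// mulrC -ler_pdivlMr// leNgt truncnS_gt//.
- move=> x [Ex /= xN] n _; have [r r01 nur] := Ex n.+1.
  by have [_ GnP _] := GP n; exact: GnP r01 nur.
Qed.
End local_maximal_finiteness.

(** * Growth of balls, and sufficiency of the growth condition *)

Section ball_growth.
Context {R : realType} {d : nat}.
Local Notation T := (borel_Rd R d).
Context (mu : {measure set T -> \bar R}).
Hypothesis hmu : forall (x : T) (r : R), 0 < r ->
  (0 < mu (eball x r))%E /\ (mu (eball x r) < +oo)%E.
Local Notation m x r := (fine (mu (eball x r))).

Lemma fine_ballK (x : T) (r : R) : 0 < r -> (m x r)%:E = mu (eball x r).
Proof. by move=> /(hmu x)[_ +]; rewrite -ge0_fin_numE// => /fineK. Qed.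

Lemma fine_ball_gt0 (x : T) (r : R) : 0 < r -> 0 < m x r.
Proof. by move=> r0; rewrite -lte_fin fine_ballK//; case: (hmu x r r0). Qed.

Lemma le_fine_ball (x y : T) (r s : R) : 0 < r ->
  edist x y + r <= s -> m x r <= m y s.
Proof.
move=> r0 rs; have s0 : 0 < s.
  by apply: lt_le_trans rs; rewrite ltr_wpDl ?euclid_ge0.
rewrite -lee_fin !fine_ballK//; apply: le_measure; rewrite ?inE;
  [exact: measurable_eball..|exact: subset_eball].
Qed.

Lemma limsup_ball_ratioP (y : T) :
  (limf_esup (ball_ratio mu y) (pinfty_nbhs R) < +oo)%E <->
  exists C M : R, 0 < M /\ forall r, M <= r -> m y (r + 1) <= C * m y r.
Proof.
split => [/ereal_inf_lt[_ [V [M [_ MV]] <-]]|[C [M [M0 CM]]]].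
  move=> Voo; have [C VC] : exists C : R,
      (ereal_sup [set ball_ratio mu y r | r in V] <= C%:E)%E.
    case: (ereal_sup _) Voo => [C _|//|_]; first by exists C.
    by exists 0; rewrite leNye.
  (* The added 1 makes the threshold positive and strictly larger than [M], as [V] is only known to
     contain the radii beyond [M]. *)
  have M1 : 0 < Num.max 0 M + 1 by rewrite ltr_wpDl// le_max lexx.
  exists C, (Num.max 0 M + 1); split => // r Mr.
  have : (ball_ratio mu y r <= C%:E)%E.
    apply: le_trans VC; apply: ereal_sup_ubound; exists r => //; apply: MV.
    by apply: lt_le_trans Mr; rewrite ltr_pwDr// le_max lexx orbT.
  rewrite /ball_ratio lee_fin ler_pdivrMr// fine_ball_gt0//.
  exact: lt_le_trans Mr.
apply: (@le_lt_trans _ _ C%:E); last by rewrite ltry.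
apply: ge_ereal_inf; exists (ereal_sup [set ball_ratio mu y r | r in [set r | M < r]]).
  exists [set r | M < r] => //.
  by exists M; split => //; exact: num_real.
apply: ge_ereal_sup => _ [r /= Mr <-].
rewrite /ball_ratio lee_fin ler_pdivrMr; first exact/CM/ltW.
by rewrite fine_ball_gt0// (lt_trans M0).
Qed.

Lemma ball_growth_gt0 (y : T) (C M : R) : 0 < M ->
  m y (M + 1) <= C * m y M -> 0 < C.
Proof.
move=> M0; have M1 : 0 < M + 1 by rewrite addr_gt0.
by move=> /(lt_le_trans (fine_ball_gt0 y _ M1)); rewrite pmulr_lgt0 ?fine_ball_gt0.
Qed.

Lemma ball_growth_iter (y : T) (C M : R) (n : nat) : 0 < M ->
  (forall r, M <= r -> m y (r + 1) <= C * m y r) ->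
  forall r, M <= r -> m y (r + n%:R) <= C ^+ n * m y r.
Proof.
move=> M0 CM; have C0 := ball_growth_gt0 y C M M0 (CM _ (lexx M)).
elim: n => [|n IH] r Mr; first by rewrite addr0 expr0 mul1r.
rewrite -natr1 addrA exprS -mulrA; apply: le_trans (CM _ _) _.
  by rewrite (le_trans Mr)// lerDl.
by rewrite ler_pM2l// IH.
Qed.

(** Form without division, valid since balls have positive finite measure. *)
Lemma lt_McP (f : T -> R) (x : T) (c : R) : (c%:E < Mc mu f x)%E <->
  exists2 r : R, 0 < r &
    (c%:E * mu (eball x r) < \int[mu]_(y in eball x r) `|f y|%:E)%E.
Proof.
have avgE r : 0 < r ->
    (c%:E < (m x r)^-1%:E * \int[mu]_(y in eball x r) `|f y|%:E)%E =
    (c%:E * mu (eball x r) < \int[mu]_(y in eball x r) `|f y|%:E)%E.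
  by move=> r0; rewrite lte_pdivlMl ?fine_ball_gt0// fine_ballK// muleC.
split => [/ereal_sup_gt[_ [r /= r0 <-]]|[r r0]]; first by rewrite avgE//; exists r.
rewrite -avgE// => /lt_le_trans; apply; apply: ereal_sup_ubound.
by exists r.
Qed.

(** Local integrability gives measurability on balls only; it is glued along the countable cover by
    balls around 0. *)
Lemma L1loc_abs (f : T -> R) : L1loc mu f ->
  measurable_fun setT (fun y => `|f y|%:E) /\
  forall x (r : R), (\int[mu]_(y in eball x r) `|f y|%:E < +oo)%E.
Proof.
move=> fL; split => [|x r].
  rewrite -bigcup_eball_nat; apply/measurable_fun_bigcup.
    by move=> n; exact: measurable_eball.
  move=> [|n].
    rewrite (_ : eball _ _ = set0); first exact: measurable_fun_set0.
    apply/seteqP; split => // z; rewrite /eball/=.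
    by rewrite ltNge euclid_ge0.
  have /integrableP[mf _] := fL 0 n.+1%:R (ltr0Sn _ n).
  exact: (measurableT_comp (@abse_measurable R setT) mf).
have r0 : 0 < Num.max r 1 by rewrite lt_max ltr01 orbT.
have /integrableP[mf +] := fL x _ r0.
apply: le_lt_trans; apply: ge0_subset_integral => //.
- exact: measurable_eball.
- exact: measurable_eball.
- exact: (measurableT_comp (@abse_measurable R setT) mf).
- by apply: subset_eball_radius; rewrite le_max lexx.
Qed.

Lemma dichotomy_of_growth (y0 : T) :
  (limf_esup (ball_ratio mu y0) (pinfty_nbhs R) < +oo)%E -> dichotomy mu.
Proof.
move=> /limsup_ball_ratioP[C [M [M0 CM]]] f /L1loc_abs[mf ff].
have g0 x : (0 <= `|f x|%:E)%E by rewrite lee_fin.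
have negE := @negligible_local_infinite R d mu (fun y => `|f y|%:E) mf g0 ff.
have [neg|nneg] := pselect (mu.-negligible [set x | Mc mu f x = +oo%E]).
  by left.
right => z; pose nu x r := (\int[mu]_(y in eball x r) `|f y|%:E)%E.
have le_nu x y (r s : R) : edist x y + r <= s -> (nu x r <= nu y s)%E.
  move=> rs; apply: ge0_subset_integral => //; last exact: subset_eball.
  - exact: measurable_eball.
  - exact: measurable_eball.
  - exact: measurable_funTS.
have nuK x r : ((fine (nu x r))%:E = nu x r)%E.
  by rewrite fineK// ge0_fin_numE ?ff// integral_ge0.
have [x Mcx [n0 xn0]] : exists2 x, Mc mu f x = +oo%E &
    exists n : nat, forall r, 0 < r <= 1 -> (nu x r <= n%:R%:E * mu (eball x r))%E.
  apply: contrapT => noex; apply: nneg; apply: negligibleS negE => x /= Mcx n.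
  apply: contrapT => nr; apply: noex; exists x => //; exists n => r r01.
  by rewrite leNgt; apply/negP => rn; apply: nr; exists r.
(* Large averages at [x] occur at large radii: [n0] bounds those over radii at most 1, and
   [nu x r2 / m x 1] those over radii between 1 and [r2]. *)
have far (K r1 : R) : exists2 r, r1 <= r & (K%:E * mu (eball x r) < nu x r)%E.
  pose r2 := Num.max r1 1.
  pose c := Num.max (Num.max K n0%:R) (fine (nu x r2) / m x 1).
  have /lt_McP[r r0 cr] : (c%:E < Mc mu f x)%E by rewrite Mcx ltry.
  have cle k : k <= c -> (k%:E * mu (eball x r) < nu x r)%E.
    by move=> kc; apply: le_lt_trans cr; rewrite lee_wpmul2r// lee_fin.
  have r_gt1 : 1 < r.
    rewrite ltNge; apply/negP => r1'; have := xn0 r; rewrite r0 r1' => /(_ isT).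
    by rewrite leNgt cle// /c !le_max lexx orbT.
  exists r; last by apply: cle; rewrite /c !le_max lexx.
  suff : r2 <= r by rewrite ge_max => /andP[].
  rewrite leNgt; apply/negP => rr2.
  have : (nu x r <= nu x r2)%E by apply: le_nu; rewrite euclidxx add0r ltW.
  apply/negP; rewrite -ltNge; apply: le_lt_trans cr.
  rewrite -nuK -fine_ballK// -EFinM lee_fin.
  rewrite (@le_trans _ _ (c * m x 1))//.
    have mx1 : 0 < m x 1 by exact: fine_ball_gt0.
    by rewrite -(ler_pdivrMr _ _ mx1) le_max lexx orbT.
  apply: ler_wpM2l; first by rewrite !le_max ler0n orbT.
  by apply: le_fine_ball => //; rewrite euclidxx add0r ltW.
apply/eqyP => c c0; apply/ltW/lt_McP.
pose b := edist x y0; pose e := edist x z.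
(* The ball of radius [r + e] at [z] lies in that of radius [r - b + n] at [y0], while the one of
   radius [r - b] at [y0] lies in [eball x r]. Hence moving from [x] to [z] costs a factor [C ^+ n]
   at most. *)
pose n := (Num.truncn (b + b + e + e)).+1.
have bn : b + b + e + e < n%:R by exact: truncnS_gt.
have [r rM cr] := far (c * C ^+ n) (M + b + 1).
have b0 : 0 <= b by exact: euclid_ge0.
have e0 : 0 <= e by exact: euclid_ge0.
have r0 : 0 < r by lra.
exists (r + e); first by lra.
apply: (@lt_le_trans _ _ (nu x r)); last by apply: le_nu; rewrite addrC.
have re0 : 0 < r + e by lra.
apply: le_lt_trans cr; rewrite -(fine_ballK z (r + e))// -(fine_ballK x r)//.
rewrite -!EFinM lee_fin -mulrA ler_pM2l//.
have zy0 : edist z y0 <= e + b by rewrite /e (euclidC x z) euclid_triangle.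
rewrite (@le_trans _ _ (m y0 (r - b + n%:R)))//.
  by apply: le_fine_ball; lra.
apply: (le_trans (ball_growth_iter y0 C M n M0 CM _ _)); first by lra.
apply: ler_wpM2l; first by rewrite exprn_ge0// ltW// (ball_growth_gt0 y0 _ M)// CM.
by apply: le_fine_ball; [lra|rewrite euclidC -/b; lra].
Qed.
End ball_growth.

(** * Necessity in positive dimension: heavy half annuli *)

Section converse.
Context {R : realType} {d : nat}.
Local Notation T := (borel_Rd R d.+1).
Context (mu : {measure set T -> \bar R}).
Hypothesis hmu : forall (x : T) (r : R), 0 < r ->
  (0 < mu (eball x r))%E /\ (mu (eball x r) < +oo)%E.
Local Notation m x r := (fine (mu (eball x r))).
Local Notation o := (0%R : T).

Let e1 : 'rV[R]_d.+1 := delta_mx ord0 ord0.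

Lemma inner_e1 (a : R) (p : 'rV[R]_d.+1) :
  \sum_i (a *: e1) ord0 i * p ord0 i = a * p ord0 ord0.
Proof.
rewrite (bigD1 ord0)//= !mxE !eqxx mulr1 big1 ?addr0// => i i0.
by rewrite !mxE (negbTE i0) andbF mulr0 mul0r.
Qed.

Lemma edist_e1 (a b : R) : edist (a *: e1) (b *: e1) = `|a - b|.
Proof.
rewrite -sqrtr_sqr; congr Num.sqrt.
rewrite (bigD1 ord0)//= !mxE !eqxx !mulr1 big1 ?addr0// => i i0.
by rewrite !mxE (negbTE i0) andbF !mulr0 subrr expr0n.
Qed.

Lemma edist0_e1 (a : R) : edist 0 (a *: e1) = `|a|.
Proof. by rewrite -(scale0r e1) edist_e1 sub0r normrN. Qed.

Definition half_annulus (s r : R) : set T :=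
  [set p : T | (r <= edist 0 p < r + 1) /\ 0 <= s * p ord0 ord0].

Lemma measurable_half_annulus (s r : R) : measurable (half_annulus s r).
Proof.
rewrite (_ : half_annulus s r = (eball o (r + 1) `\` eball o r) `\`
    [set p : T | s * p ord0 ord0 < 0]).
  apply: measurableD; first by apply: measurableD; exact: measurable_eball.
  apply: sub_sigma_algebra.
  rewrite (_ : [set p | _] =
    (fun p : 'rV[R]_d.+1 => s * p ord0 ord0) @^-1` [set z | z < 0])//.
  apply: open_comp; last exact: open_lt.
  move=> p _; apply: (@continuousM _ _ (fun=> s)); first exact: cst_continuous.
  exact: (@coord_continuous R 1 d.+1 ord0 ord0 p).
apply/seteqP; split => p; rewrite /half_annulus /eball /=.
  by move=> [/andP[rp pr] sp]; rewrite pr; do !split => //; apply/negP; rewrite -leNgt.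
by move=> [[-> /negP]]; rewrite -leNgt => -> /negP; rewrite -leNgt.
Qed.

(** If both signs failed, with constants [K1] and [K2], the two halves would cover the annulus and
    bound the ball ratio by [1 + K1 + K2]. Thus one sign works for all [K] and [M]. *)
Lemma heavy_half_annulus :
  ~ (limf_esup (ball_ratio mu o) (pinfty_nbhs R) < +oo)%E ->
  exists2 s : R, s ^+ 2 = 1 & forall K M : R, exists r : R, M <= r /\
    ((K * m o r)%:E <= mu (half_annulus s r))%E.
Proof.
move=> ninf; apply: contrapT => noheavy; apply: ninf.
have light (s : R) : s ^+ 2 = 1 -> exists K M : R, forall r, M <= r ->
    (mu (half_annulus s r) <= (K * m o r)%:E)%E.
  move=> s1; apply: contrapT => nl; apply: noheavy; exists s => // K M.
  apply: contrapT => nr; apply: nl; exists K, M => r Mr.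
  by apply/ltW; rewrite ltNge; apply/negP => rK; apply: nr; exists r.
have [K1 [M1 L1]] := light 1 (expr1n _ _).
have [K2 [M2 L2]] := light (- 1) (etrans (sqrrN 1) (expr1n _ _)).
apply/(limsup_ball_ratioP _ hmu); exists (1 + K1 + K2), (Num.max 1 (Num.max M1 M2)).
split; first by rewrite lt_max ltr01.
move=> r; rewrite !ge_max => /and3P[r1 rM1 rM2].
rewrite -lee_fin (fine_ballK _ hmu); last lra.
rewrite !mulrDl mul1r !EFinD.
apply: (@le_trans _ _ (mu (eball o r) + mu (half_annulus 1 r)
   + mu (half_annulus (- 1) r))%E).
  have mB := measurable_eball o; have mH := measurable_half_annulus.
  apply: le_trans (leeD2r _ (measureU2 mu (mB r) (mH 1 r))).
  apply: le_trans (measureU2 mu (measurableU _ _ (mB r) (mH 1 r)) (mH (- 1) r)).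
  apply: le_measure; rewrite ?inE//; first by repeat apply: measurableU.
  move=> p pr; have [pr'|rp] := ltP (edist 0 p) r; first by left; left.
  have [p0|p0] := leP 0 (p ord0 ord0).
    by left; right; split; [rewrite rp|rewrite mul1r].
  by right; split; [rewrite rp|rewrite mulN1r oppr_ge0 ltW].
by rewrite !leeD ?L1 ?L2// (fine_ballK _ hmu)//; lra.
Qed.

(** * The function violating the dichotomy *)

Section witness.
Context (s : R) (r : nat -> R).
Hypothesis s1 : s ^+ 2 = 1.
Hypothesis r_incr : forall k, r k + 1 <= r k.+1.
Hypothesis r0 : 3 <= r 0.
Hypothesis r_heavy : forall k,
  ((4 ^+ k * m o (r k))%:E <= mu (half_annulus s (r k)))%E.

Let q k : 'rV[R]_d.+1 := (- (s * (r k - 1))) *: e1.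
Let Q k : set T := eball (q k) 4^-1.
(** Normalized so that the integral of [a k] over [Q k] is [2 ^+ k * m o (r k)]. *)
Let a k : R := 2 ^+ k * m o (r k) / m (q k) 4^-1.
(** The series of all [a k * \1_(Q k)], cut at a point-dependent index so that no convergence is
    involved. *)
Let f (y : T) : R :=
  \sum_(0 <= k < (Num.truncn (edist 0 y)).+1) a k * \1_(Q k) y.

Let norm_s : `|s| = 1.
Proof. by apply/eqP; rewrite -sqrp_eq1 ?normr_ge0// real_normK ?num_real ?s1. Qed.

Let r_ge k : k%:R + 3 <= r k.
Proof.
elim: k => [|k IH]; first by rewrite add0r.
by rewrite -natr1; have := r_incr k; lra.
Qed.

Let r_ge3 k : 3 <= r k.
Proof. by apply: le_trans (r_ge k); rewrite lerDr. Qed.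

Let m_mono i j : (i <= j)%N -> m o (r i) <= m o (r j).
Proof.
move=> ij; apply: (le_fine_ball _ hmu); first by have := r_ge3 i; lra.
rewrite euclidxx add0r; elim: j ij => [|j IH]; first by rewrite leqn0 => /eqP->.
rewrite leq_eqVlt ltnS => /predU1P[->//|/IH]; have := r_incr j; lra.
Qed.

Let a_ge0 k : 0 <= a k.
Proof. by rewrite divr_ge0 ?mulr_ge0 ?fine_ge0 ?exprn_ge0. Qed.

Let mass_Q k : ((a k)%:E * mu (Q k) = (2 ^+ k * m o (r k))%:E)%E.
Proof.
have q0 : (0 : R) < 4^-1 by rewrite invr_gt0.
rewrite /Q -(fine_ballK _ hmu (q k))// -EFinM /a divfK// gt_eqF//.
exact: (fine_ball_gt0 _ hmu).
Qed.

(** A point of [Q k] has norm above [r k - 5/4], hence above [k], so the terms beyond the cut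
    vanish. *)
Let f_sum n y : edist 0 y < n%:R -> f y = \sum_(0 <= k < n) a k * \1_(Q k) y.
Proof.
move=> yn; rewrite [RHS](@big_cat_nat _ _ _ (Num.truncn (edist 0 y)).+1)//=; last first.
  rewrite -(ltr_nat R) (le_lt_trans _ yn)//.
  by have /andP[] := truncn_itv (euclid_ge0 0 y).
rewrite [X in _ + X]big_nat [X in _ + X]big1 ?addr0// => k /andP[yk _].
rewrite indicE memNset ?mulr0//; rewrite /Q /eball/= => kq.
have := euclid_triangle y 0 (q k); rewrite edist0_e1 normrN normrM norm_s mul1r.
rewrite (euclidC y) ger0_norm; last by have := r_ge3 k; lra.
have := truncnS_gt (edist 0 y).
have : (Num.truncn (edist 0 y)).+1%:R <= k%:R :> R by rewrite ler_nat.
have := r_ge k; lra.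
Qed.

Let integral_f (B : set T) n : measurable B -> B `<=` eball o n%:R ->
  measurable_fun B f /\
  (\int[mu]_(y in B) `|f y|%:E = \sum_(0 <= k < n) (a k)%:E * mu (Q k `&` B))%E.
Proof.
move=> mB Bn.
have mQ k : measurable (Q k) by exact: measurable_eball.
have fB y : B y -> f y = \sum_(0 <= k < n) a k * \1_(Q k) y.
  by move=> /Bn; exact: f_sum.
have maQ k : measurable_fun B (fun y => a k * \1_(Q k) y).
  by apply: measurable_funM => //; exact: measurable_indic.
split.
  apply: (eq_measurable_fun (fun y => \sum_(0 <= k < n) a k * \1_(Q k) y)).
    by move=> y /[!inE] /fB.
  exact: measurable_sum.
rewrite (eq_integral (fun y => \sum_(0 <= k < n) (a k)%:E * (\1_(Q k) y)%:E)%E).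
  rewrite ge0_integral_sum//.
  - apply: eq_bigr => k _; rewrite ge0_integralZl ?lee_fin//.
    + by rewrite integral_indic.
    + by apply/measurable_EFinP; exact: measurable_indic.
  - by move=> k; apply/measurable_EFinP; exact: maQ.
  - by move=> k y _; rewrite -EFinM lee_fin mulr_ge0.
move=> y /[!inE] By; rewrite ger0_norm fB ?sumr_ge0//; last first.
  by move=> k _; rewrite mulr_ge0.
by rewrite -sumEFin.
Qed.

Let L1loc_f : L1loc mu f.
Proof.
move=> x t t0; pose n := (Num.truncn (edist x 0 + t)).+1.
have [||mf intf] := integral_f (eball x t) n.
- exact: measurable_eball.
- by apply: subset_eball; rewrite ltW// truncnS_gt.
apply/integrableP; split; first exact/measurable_EFinP.
rewrite [X in (X < _)%E]intf; apply/lte_sum_pinfty => k _.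
rewrite lte_mul_pinfty ?lee_fin//; apply: (@le_lt_trans _ _ (mu (Q k))).
  by apply: le_measure; rewrite ?inE;
    [apply: measurableI|..]; try exact: measurable_eball; exact: subIsetl.
by have [] := hmu (q k) 4^-1 (ltac:(by rewrite invr_gt0)).
Qed.

Let Mc_f_infinite x : edist 0 x < 4^-1 -> Mc mu f x = +oo%E.
Proof.
move=> x0; apply/eqyP => c c0; apply/ltW/(lt_McP _ hmu).
have [k ck] : exists k : nat, c < 2 ^+ k.
  exists (Num.truncn c).+1; apply: lt_trans (truncnS_gt c) _.
  by rewrite -natrX ltr_nat ltn_expl.
(* From [x], the points of [Q k] are closer than [1/4 + (r k - 1) + 1/4], which is this radius; as
   [edist 0 x < 1/4], the ball stays inside [eball o (r k)]. *)
have rk := r_ge3 k; exists (r k - 2^-1); first lra.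
set B := eball x _; pose n := maxn k.+1 (Num.truncn (r k)).+1.
have B_rk : B `<=` eball o (r k).
  by apply: subset_eball; rewrite euclidC; lra.
have [||_ ->] := integral_f B n.
- exact: measurable_eball.
- apply: subset_trans B_rk _; apply: subset_eball_radius.
  rewrite (le_trans (ltW (truncnS_gt (r k))))// ler_nat; exact: leq_maxr.
have QB : Q k `<=` B.
  apply: subset_eball.
  have := euclid_triangle o (q k) x; rewrite (euclidC (q k) 0) edist0_e1.
  rewrite normrN normrM norm_s mul1r ger0_norm; last lra.
  by lra.
rewrite big_mkord (bigD1 (Ordinal (leq_maxl k.+1 (Num.truncn (r k)).+1)))//=.
apply: (@lt_le_trans _ _ ((a k)%:E * mu (Q k `&` B))%E); last first.
  by rewrite leeDl// sume_ge0// => i _; rewrite mule_ge0 ?lee_fin.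
rewrite setIidl// mass_Q /B -(fine_ballK _ hmu x); last lra.
rewrite -EFinM lte_fin.
have rk0 : 0 < m o (r k) by apply: (fine_ball_gt0 _ hmu); lra.
apply: (@le_lt_trans _ _ (c * m o (r k))); last by rewrite ltr_pM2r.
rewrite ler_pM2l//; apply: (le_fine_ball _ hmu); first lra.
by rewrite euclidC; lra.
Qed.

Let Mc_f_finite : exists z, Mc mu f z <> +oo%E.
Proof.
exists ((4 * s) *: e1); set z := _ *: e1 => Mcz.
have /(lt_McP _ hmu)[t t0] : (2%:E < Mc mu f z)%E by rewrite Mcz ltry.
apply/negP; rewrite -leNgt; set B := eball z t.
have mB : measurable B by exact: measurable_eball.
have [||_ ->] := integral_f B (Num.truncn (edist z 0 + t)).+1 => //.
  by apply: subset_eball; rewrite ltW// truncnS_gt.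
(* Induction on the number of terms removes the last ones as long as [Q n] misses [B]. When it meets
   [B], the remaining sum is controlled by the half annulus of index [n]. *)
elim: (_.+1) => [|n IH]; first by rewrite big_geq// mule_ge0 ?lee_fin.
have [[u [Qu Bu]]|QB0] := pselect (Q n `&` B !=set0); last first.
  rewrite big_nat_recr//= (_ : Q n `&` B = set0) ?measure0 ?mule0 ?adde0//.
  by apply/eqP; apply: contrapT => /negP/set0P.
(* Meeting [Q n] forces [t > r n + 11/4]. For [p] in the half annulus the inner product of [z] and
   [p] is nonnegative, so the squared distance is below [16 + (r n + 1) ^+ 2], which is less than
   [(r n + 11/4) ^+ 2] because [r n >= 3]. *)
have B_annulus : half_annulus s (r n) `<=` B.
  move=> p [/andP[_ pr] sp]; rewrite /B /eball/=.
  have rn := r_ge3 n.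
  have zq : edist z (q n) = r n + 3.
    rewrite edist_e1 (_ : _ - _ = s * (r n + 3)); last by ring.
    by rewrite normrM norm_s mul1r ger0_norm//; lra.
  have zu : r n + 3 < t + 4^-1.
    rewrite -zq; apply: le_lt_trans (euclid_triangle u _ _) _.
    by rewrite ltrD// euclidC.
  apply: (@lt_trans _ _ (r n + 11 / 4)); last lra.
  rewrite -(ltr_pXn2r (ltn0Sn 1)) ?nnegrE ?euclid_ge0//; last lra.
  rewrite (sqr_edistE 0) (euclidC z) (euclidC p) edist0_e1 normrM norm_s.
  rewrite mulr1 ger0_norm//.
  have -> : \sum_i (z ord0 i - (0 : 'rV[R]_d.+1) ord0 i) *
      (p ord0 i - (0 : 'rV[R]_d.+1) ord0 i) = 4 * s * p ord0 ord0.
    by rewrite -inner_e1; apply: eq_bigr => i _; rewrite !mxE !subr0.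
  by have := euclid_ge0 0 p; nra.
have rn_m : ((4 ^+ n * m o (r n))%:E <= mu B)%E.
  apply: le_trans (r_heavy n) _; apply: le_measure; rewrite ?inE//.
  exact: measurable_half_annulus.
(* The masses up to [n] add up to at most [(2 ^+ n.+1 - 1) * m o (r n)], which is at most twice
   [4 ^+ n * m o (r n)], hence at most twice the measure of [B]. *)
apply: (@le_trans _ _ (\sum_(0 <= k < n.+1) (2 ^+ k * m o (r n))%:E)%E).
  rewrite !big_nat; apply: lee_sum => k /andP[_ kn].
  apply: (@le_trans _ _ ((a k)%:E * mu (Q k))%E).
    rewrite lee_wpmul2l ?lee_fin//; apply: le_measure; rewrite ?inE;
      [apply: measurableI|..|exact: subIsetl]; exact: measurable_eball.
  by rewrite mass_Q lee_fin ler_wpM2l ?exprn_ge0// m_mono.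
apply: (@le_trans _ _ (2%:E * (4 ^+ n * m o (r n))%:E)%E); last first.
  by rewrite lee_wpmul2l ?lee_fin.
rewrite sumEFin -EFinM lee_fin -mulr_suml mulrA ler_wpM2r ?fine_ge0//.
rewrite (_ : 4 = 2 * 2 :> R); last by ring.
rewrite exprMn; have : 1 <= 2 ^+ n :> R by rewrite exprn_ege1// ler1n.
suff : \sum_(0 <= k < n.+1) 2 ^+ k = 2 ^+ n.+1 - 1 :> R.
  by move=> ->; rewrite exprS; nra.
elim: n.+1 => [|j IHj]; first by rewrite big_geq// subrr.
by rewrite big_nat_recr//= IHj exprS; ring.
Qed.

Lemma not_dichotomy_of_heavy : ~ dichotomy mu.
Proof.
move=> /(_ f L1loc_f)[neg|all]; last by have [z] := Mc_f_finite; exact.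
have q0 : (0 : R) < 4^-1 by rewrite invr_gt0.
have : mu (eball o 4^-1) = 0%E.
  apply/negligibleP; first exact: measurable_eball.
  by apply: negligibleS neg => x; exact: Mc_f_infinite.
by move=> m0; have := (hmu 0 _ q0).1; rewrite m0 ltxx.
Qed.
End witness.

Lemma growth_of_dichotomy : dichotomy mu ->
  (limf_esup (ball_ratio mu o) (pinfty_nbhs R) < +oo)%E.
Proof.
move=> dich; apply: contrapT => /heavy_half_annulus[s s1 heavy].
have [phi phiP] := choice (fun KM : R * R => heavy KM.1 KM.2).
(* The first component asks for heaviness [4 ^+ k], the second for a gap of at least 1; the initial
   pair encodes [4 ^+ 0] and the starting radius 3. *)
pose r := fix r k := if k is k'.+1 then phi (4 ^+ k, r k' + 1) else phi (1, 3).
apply: (@not_dichotomy_of_heavy s r) => //.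
- by move=> k; have [] := phiP (4 ^+ k.+1, r k + 1).
- by have [] := phiP (1, 3).
- by case=> [|k]; [have [] := phiP (1, 3)|have [] := phiP (4 ^+ k.+1, r k + 1)].
Qed.
End converse.

Theorem theorem6p4p1 (R : realType) (d : nat)
  (mu : {measure set (borel_Rd R d) -> \bar R})
  (hmu : forall (x : borel_Rd R d) (r : R), 0 < r ->
     (0 < mu (eball x r))%E /\ (mu (eball x r) < +oo)%E) :
  dichotomy mu <->
  exists y0 : borel_Rd R d,
    (limf_esup (ball_ratio mu y0) (pinfty_nbhs R) < +oo)%E.
Proof.
split=> [|[y0]]; last exact: dichotomy_of_growth.
(* In dimension 0 there is no first coordinate to split along, but all distances vanish and the ball
   ratio is 1. *)
case: d mu hmu => [|d] mu hmu dich; exists 0; last exact: growth_of_dichotomy.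
apply/(limsup_ball_ratioP _ hmu); exists 1, 1; split => // r r1.
have edist00 (x y : 'rV[R]_0) : edist x y = 0 by rewrite /edist big_ord0 sqrtr0.
rewrite mul1r (_ : eball 0 (r + 1) = eball 0 r)//.
by apply/seteqP; split => x; rewrite /eball/= !edist00; lra.
Qed.
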